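(* Let $n\ge 1$ be an integer, let $k$ be a field, and let $R$ be a positively graded $k$-algebra generated by finitely many homogeneous elements of degree coprime to $n$. Let $M$ be a graded $R$-module such that $\operatorname{Ass}_R(M)\subseteq\operatorname{Proj}(R)$. Then $${}^*E_{R^{(n)}}(M^{(n)})=({}^*E_R(M))^{(n)}.$$
   Context: All rings are commutative and Noetherian with identity. A positively graded $k$-algebra is an $\mathbb N$-graded ring $R=\bigoplus_{i\ge0}R_i$ with $R_0=k$; its homogeneous maximal ideal is $\mathfrak m=\bigoplus_{i>0}R_i$, and $\operatorname{Proj}(R)$ is the set of homogeneous primes other than $\mathfrak m$. Graded modules are $\mathbb Z$-graded and graded maps preserve degree. The Veronese ring $R^{(n)}$ is $\bigoplus_{n\mid i}R_i\subseteq R$ and, for a graded $R$-module $M$, $M^{(n)}$ is the graded $R^{(n)}$-module $\bigoplus_{n\mid i}M_i$ (degrees not rescaled). A *injective module is an injective object of the category of graded modules and graded maps. An inclusion $M\subseteq N$ of graded modules is *essential if every nonzero graded submodule of $N$ meets $M$ nontrivially. ${}^*E_R(M)$, the *injective hull of $M$, is the maximal *essential extension of $M$; it is *injective and unique up to graded isomorphism. The equality means that $M^{(n)}\subseteq({}^*E_R(M))^{(n)}$ is a *injective hull over $R^{(n)}$. *)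

(* Defs.v *)
From HB Require Import structures.
From mathcomp Require Import all_boot all_order all_algebra.
From mathcomp Require Import boolp.

Set Implicit Arguments.
Unset Strict Implicit.
Unset Printing Implicit Defensive.

Import Order.TTheory GRing.Theory Num.Theory.
Local Open Scope ring_scope.

(* Gradings are internal: a family of additive subgroups [D i] of one abelian
   group.  Boolean predicates are used throughout (through [`[< _ >]] of boolp,
   every Prop-valued predicate is of this form). *)

Section Decompositions.
Variables (I : eqType) (V : zmodType).
Implicit Types (D : I -> {pred V}) (Q : pred I) (N : {pred V}).

(* \sum_(i | Q i) D i, as a set of finite sums of homogeneous elements *)
Definition graded_part D Q : {pred V} := fun x =>
  `[< exists2 s : seq V,
        {in s, forall y, exists2 i, Q i & y \in D i} & x = \sum_(y <- s) y >].

Definition direct_decomposition D : Prop :=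
  [/\ forall i, zmod_closed (D i),
      forall x, x \in graded_part D xpredT
    & forall (s : seq I) (c : I -> V),
        uniq s -> {in s, forall i, c i \in D i} ->
        \sum_(i <- s) c i = 0 -> {in s, forall i, c i = 0}].

(* N is the sum of the N :&: D i *)
Definition homogeneous D N : Prop :=
  {in N, forall x, x \in graded_part (fun i => [predI D i & N]) xpredT}.

Lemma graded_partP D Q x : reflect
  (exists2 s : seq V,
     {in s, forall y, exists2 i, Q i & y \in D i} & x = \sum_(y <- s) y)
  (x \in graded_part D Q).
Proof. exact: asboolP. Qed.

Lemma graded_part_hom D (Q : pred I) i x :
  Q i -> x \in D i -> x \in graded_part D Q.
Proof.
move=> Qi Dx; apply/graded_partP; exists [:: x]; last by rewrite big_seq1.
by move=> y; rewrite inE => /eqP->; exists i.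
Qed.

Lemma graded_part0 D Q : 0 \in graded_part D Q.
Proof. by apply/graded_partP; exists [::]; rewrite ?big_nil. Qed.

Lemma graded_partD D Q x y :
  x \in graded_part D Q -> y \in graded_part D Q -> x + y \in graded_part D Q.
Proof.
move=> /graded_partP[s Ds ->] /graded_partP[t Dt ->]; apply/graded_partP.
exists (s ++ t); last by rewrite big_cat.
by move=> z; rewrite mem_cat => /orP[/Ds|/Dt].
Qed.

Lemma graded_part_closed D Q :
  (forall i, zmod_closed (D i)) -> zmod_closed (graded_part D Q).
Proof.
move=> D_closed; split=> [|x y Dx /graded_partP[s Ds ->]].
  exact: graded_part0.
apply: graded_partD => //; apply/graded_partP.
exists [seq - z | z <- s]; last by rewrite big_map sumrN.
move=> _ /mapP[z /Ds[i Qi Dz] ->]; exists i => //.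
by case: (D_closed i) => D0 DB; rewrite -sub0r DB.
Qed.

End Decompositions.

Lemma sub_direct_decomposition (I : eqType) (V W : zmodType)
    (f : {additive W -> V}) (D : I -> {pred V}) (Q : pred I) :
    injective f ->
    (forall w, f w \in graded_part D Q) ->
    (forall i x, Q i -> x \in D i -> exists w, f w = x) ->
  direct_decomposition D ->
  direct_decomposition (fun i => [pred w | f w \in D i]).
Proof.
move=> f_inj fW fD [D_closed D_span D_indep]; split.
- move=> i; case: (D_closed i) => D0 DB.
  by split=> [|x y]; rewrite !inE ?raddf0 // raddfB; apply: DB.
- move=> w; case/graded_partP: (fW w) => s Ds fw.
  suff [t Dt ft]: exists2 t : seq W,
      {in t, forall y, exists2 i, xpredT i & y \in [pred w | f w \in D i]}
      & f w = f (\sum_(y <- t) y).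
    by apply/graded_partP; exists t => //; apply: f_inj.
  rewrite fw; elim: s Ds {fw} => [|x s IHs] Ds.
    by exists [::]; rewrite // !big_nil raddf0.
  have [i Qi Dx] := Ds x (mem_head x s).
  have [v fv] := fD i x Qi Dx.
  have [|t Dt ft] := IHs; first by move=> y sy; apply: Ds; rewrite inE sy orbT.
  exists (v :: t); last by rewrite !big_cons raddfD /= fv ft.
  move=> y; rewrite inE => /predU1P[->|/Dt//].
  by exists i; rewrite ?inE ?fv.
- move=> s c s_uniq Dc c0 i si; apply: f_inj; rewrite raddf0.
  apply: (D_indep s (f \o c)) si => //.
  by rewrite -[LHS]/(\sum_(j <- s) f (c j)) -raddf_sum c0 raddf0.
Qed.

Record gradedRing := GradedRing {
  gring_sort :> comNzRingType;
  gring_comp : nat -> {pred gring_sort};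
  gring_direct : direct_decomposition gring_comp;
  gring_comp1 : 1 \in gring_comp 0%N;
  gring_compM : forall i j x y, x \in gring_comp i -> y \in gring_comp j ->
    x * y \in gring_comp (i + j)%N
}.

Record gradedModule (R : gradedRing) := GradedModule {
  gmod_sort :> lmodType R;
  gmod_comp : int -> {pred gmod_sort};
  gmod_direct : direct_decomposition gmod_comp;
  gmod_compZ : forall i j (a : R) x, a \in gring_comp i -> x \in gmod_comp j ->
    a *: x \in gmod_comp (i%:Z + j)
}.

Record gradedHom (R : gradedRing) (M N : gradedModule R) := GradedHom {
  ghom_fun :> {linear M -> N};
  ghom_comp : forall i x, x \in gmod_comp i -> ghom_fun x \in gmod_comp i
}.

Record posGradedAlgebra (k : fieldType) := PosGradedAlgebra {
  pga_sort :> comAlgType k;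
  pga_comp : nat -> {pred pga_sort};
  pga_direct : direct_decomposition pga_comp;
  pga_compM : forall i j x y, x \in pga_comp i -> y \in pga_comp j ->
    x * y \in pga_comp (i + j)%N;
  pga_comp0 : forall x, x \in pga_comp 0%N <-> exists c : k, x = c%:A
}.

Lemma pga_comp1 k (R : posGradedAlgebra k) : 1 \in @pga_comp k R 0%N.
Proof. by apply/pga_comp0; exists 1; rewrite scale1r. Qed.

Coercion pga_gradedRing k (R : posGradedAlgebra k) : gradedRing :=
  GradedRing (@pga_direct k R) (@pga_comp1 k R) (@pga_compM k R).

Definition alg_generated (k : fieldType) (A : comAlgType k) (s : seq A) : Prop :=
  forall S : {pred A}, subalg_closed S -> {subset s <= S} -> forall x, x \in S.

(* [idealr_closed] includes properness *)
Definition prime_ideal (R : comNzRingType) (P : {pred R}) : Prop :=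
  idealr_closed P /\ prime_idealr_closed P.

Definition irrelevant_ideal (R : gradedRing) : {pred R} :=
  graded_part (@gring_comp R) (fun i => (0 < i)%N).
Arguments irrelevant_ideal R : clear implicits.

Definition in_Proj (R : gradedRing) (P : {pred R}) : Prop :=
  [/\ prime_ideal P, homogeneous (@gring_comp R) P & ~ P =i irrelevant_ideal R].

Definition in_Ass (R : comNzRingType) (M : lmodType R) (P : {pred R}) : Prop :=
  prime_ideal P /\ exists x : M, forall a, a \in P <-> a *: x = 0.

Section Hull.
Variable R : gradedRing.

Definition star_essential (M N : gradedModule R) (f : M -> N) : Prop :=
  forall S : {pred N}, submod_closed S -> homogeneous (@gmod_comp R N) S ->
  (exists2 y, y \in S & y != 0) -> exists2 x : M, f x \in S & f x != 0.

(* E is a maximal *essential extension of M: every graded embedding of E that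
   stays *essential over M is onto. *)
Definition star_injective_hull (M E : gradedModule R) (f : gradedHom M E) : Prop :=
  [/\ injective f, star_essential f
    & forall (F : gradedModule R) (g : gradedHom E F),
        injective g -> star_essential (g \o f) -> forall y, exists x, g x = y].

End Hull.

Section VeroneseRing.
Variables (n : nat) (R : gradedRing).

Definition veronese_pred : {pred R} :=
  graded_part (@gring_comp R) (fun i => (n %| i)%N).

Fact veronese_subring : subring_closed veronese_pred.
Proof.
have [Rz _ _] := gring_direct R.
have [V0 VB] := graded_part_closed (fun i => (n %| i)%N) Rz.
split=> //.
  exact: graded_part_hom (dvdn0 n) (gring_comp1 R).
move=> x y /graded_partP[s Ds ->] /graded_partP[t Dt ->]; apply/graded_partP.
exists [seq u * v | u <- s, v <- t]; last by rewrite big_allpairs_dep big_distrlr.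
move=> _ /allpairsP[[u v] [/Ds[i ni Du] /Dt[j nj Dv] ->]].
by exists (i + j)%N; [exact: dvdn_add | exact: gring_compM].
Qed.

HB.instance Definition _ := GRing.isSubringClosed.Build R veronese_pred
  veronese_subring.

Definition veronese_sort := {x : R | x \in veronese_pred}.
HB.instance Definition _ := SubChoice.on veronese_sort.
HB.instance Definition _ :=
  [SubChoice_isSubComNzRing of veronese_sort by <:].

(* The degrees are those of R, so the component of degree i is 0 unless n
   divides i. *)
Definition veronese_comp (i : nat) : {pred veronese_sort} :=
  [pred x | val x \in gring_comp i].

Fact veronese_direct : direct_decomposition veronese_comp.
Proof.
apply: (@sub_direct_decomposition _ _ _ (val : {additive veronese_sort -> R})
  _ (fun i => (n %| i)%N)) (gring_direct R).
- exact: val_inj.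
- by move=> w; exact: valP.
move=> i x ni Dx; have Vx : x \in veronese_pred by exact: graded_part_hom ni Dx.
by exists (Sub x Vx); exact: SubK.
Qed.

Fact veronese_comp1 : 1 \in veronese_comp 0.
Proof. by rewrite inE /= gring_comp1. Qed.

Fact veronese_compM i j x y : x \in veronese_comp i -> y \in veronese_comp j ->
  x * y \in veronese_comp (i + j).
Proof. by rewrite !inE rmorphM /=; exact: gring_compM. Qed.

Definition veronese_ring : gradedRing :=
  GradedRing veronese_direct veronese_comp1 veronese_compM.

End VeroneseRing.

Section VeroneseModule.
Variables (n : nat) (R : gradedRing) (M : gradedModule R).

Definition veronese_mod_pred : {pred M} :=
  graded_part (@gmod_comp R M) (fun i => (n%:Z %| i)%Z).

Fact veronese_mod_zmod : zmod_closed veronese_mod_pred.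
Proof. by have [Mz _ _] := gmod_direct M; exact: graded_part_closed. Qed.

HB.instance Definition _ := GRing.isZmodClosed.Build M veronese_mod_pred
  veronese_mod_zmod.

Definition veronese_mod_sort := {x : M | x \in veronese_mod_pred}.
HB.instance Definition _ := SubChoice.on veronese_mod_sort.
HB.instance Definition _ := [SubChoice_isSubZmodule of veronese_mod_sort by <:].

Fact veronese_modZ (a : veronese_ring n R) (x : veronese_mod_sort) :
  (val a : R) *: val x \in veronese_mod_pred.
Proof.
case/graded_partP: (valP a) => s Ds ->; case/graded_partP: (valP x) => t Dt ->.
apply/graded_partP; exists [seq u *: v | u <- s, v <- t].
  move=> _ /allpairsP[[u v] [/Ds[i ni Du] /Dt[j nj Dv] ->]].
  by exists (i%:Z + j); [exact: rpredD | exact: gmod_compZ].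
rewrite big_allpairs_dep scaler_suml; apply: eq_bigr => u _.
by rewrite scaler_sumr.
Qed.

Definition veronese_scale (a : veronese_ring n R) (x : veronese_mod_sort) :
  veronese_mod_sort := Sub ((val a : R) *: val x) (veronese_modZ a x).

Fact veronese_scalerA a b x :
  veronese_scale a (veronese_scale b x) = veronese_scale (a * b) x.
Proof. by apply: val_inj; rewrite /= scalerA. Qed.

Fact veronese_scale1r : left_id 1 veronese_scale.
Proof. by move=> x; apply: val_inj; rewrite /= scale1r. Qed.

Fact veronese_scalerDr : right_distributive veronese_scale +%R.
Proof. by move=> a x y; apply: val_inj; rewrite /= scalerDr. Qed.

Fact veronese_scalerDl x : {morph veronese_scale^~ x : a b / a + b}.
Proof. by move=> a b; apply: val_inj; rewrite /= scalerDl. Qed.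

HB.instance Definition _ := GRing.Zmodule_isLmodule.Build (veronese_ring n R)
  veronese_mod_sort veronese_scalerA veronese_scale1r veronese_scalerDr
  veronese_scalerDl.

Definition veronese_mod_comp (i : int) : {pred veronese_mod_sort} :=
  [pred x | val x \in gmod_comp i].

Fact veronese_mod_direct : direct_decomposition veronese_mod_comp.
Proof.
apply: (@sub_direct_decomposition _ _ _
  (val : {additive veronese_mod_sort -> M})
  _ (fun i => (n%:Z %| i)%Z)) (gmod_direct M).
- exact: val_inj.
- by move=> w; exact: valP.
move=> i x ni Dx.
have Vx : x \in veronese_mod_pred by exact: graded_part_hom ni Dx.
by exists (Sub x Vx); exact: SubK.
Qed.

Fact veronese_mod_compZ i j (a : veronese_ring n R) x :
    a \in gring_comp i -> x \in veronese_mod_comp j ->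
  a *: x \in veronese_mod_comp (i%:Z + j).
Proof. by rewrite !inE; exact: gmod_compZ. Qed.

Definition veronese_mod : gradedModule (veronese_ring n R) :=
  GradedModule veronese_mod_direct veronese_mod_compZ.

End VeroneseModule.

Section VeroneseHom.
Variables (n : nat) (R : gradedRing) (M N : gradedModule R).
Variable f : gradedHom M N.

Fact veronese_hom_subproof (x : veronese_mod n M) :
  f (val x) \in veronese_mod_pred n (M := N).
Proof.
case/graded_partP: (valP x) => s Ds ->; apply/graded_partP.
exists [seq f y | y <- s]; last by rewrite big_map raddf_sum.
by move=> _ /mapP[y /Ds[i ni Dy] ->]; exists i => //; exact: ghom_comp.
Qed.

Definition veronese_fun (x : veronese_mod n M) : veronese_mod n N :=
  Sub (f (val x)) (veronese_hom_subproof x).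

Fact veronese_fun_linear : linear veronese_fun.
Proof. by move=> a x y; apply: val_inj; rewrite /= linearP. Qed.

HB.instance Definition _ := GRing.isLinear.Build (veronese_ring n R)
  (veronese_mod n M) (veronese_mod n N) *:%R veronese_fun veronese_fun_linear.

Fact veronese_fun_comp i x :
  x \in gmod_comp i -> veronese_fun x \in gmod_comp i.
Proof. by rewrite !inE; exact: ghom_comp. Qed.

Definition veronese_hom : gradedHom (veronese_mod n M) (veronese_mod n N) :=
  @GradedHom _ (veronese_mod n M) (veronese_mod n N) veronese_fun
    veronese_fun_comp.

End VeroneseHom.

(* Main.v *)
(* Let F be a *essential extension of E^(n) over R^(n), and let
   H = *Hom_{R^(n)}(R, F), an R-module.  Both E and F map to H: e goes to
   r |-> (re)_(n), where (-)_(n) is the projection on the degrees divisible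
   by n, and y goes to r |-> r_(n) y; the two maps agree on E^(n).

   As the maximal ideal is not associated to M, no nonzero element of E is
   killed by all the generators.  Hence a nonzero homogeneous x in E has a
   homogeneous multiple ax with g^n ax <> 0 for some generator g (otherwise all
   generators would act nilpotently on Rx), and, the degree of g being coprime
   to n, some g^m ax is a nonzero element of degree divisible by n.  So E -> H
   is injective; the same fact shows that M^(n) is *essential in E^(n).

   By *essentiality F lives in degrees divisible by n, so a homogeneous h in H
   with h(a) <> 0, a homogeneous, satisfies ah = (r |-> r_(n) h(a)): nonzero
   graded submodules of H meet F, hence M^(n).  Thus H is *essential over M,
   E -> H is onto by maximality of E, and if e is a preimage of the image of
   y in F, evaluation at 1 shows that y is the image of e_(n). *)

From HB Require Import structures.
Require Import Defs.
From mathcomp Require Import all_boot all_order all_algebra.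
From mathcomp Require Import boolp functions.

Set Implicit Arguments.
Unset Strict Implicit.
Unset Printing Implicit Defensive.

Import GRing.Theory.
Local Open Scope ring_scope.

(** * Sums of homogeneous elements with degrees in a given set *)

Section GradedPart.
Variables (I : eqType) (V : zmodType).
Implicit Types (D : I -> {pred V}) (Q : pred I).

Lemma graded_part_ind D Q (P : V -> Prop) :
    P 0 ->
    (forall i x y, Q i -> x \in D i -> y \in graded_part D Q ->
       P y -> P (x + y)) ->
  forall x, x \in graded_part D Q -> P x.
Proof.
move=> P0 PD x /graded_partP[s Ds ->]; elim: s Ds => [|y s IHs] Ds.
  by rewrite big_nil.
have Ds' : {in s, forall y, exists2 i, Q i & y \in D i}.
  by move=> z sz; apply: Ds; rewrite inE sz orbT.
have [i Qi Dy] := Ds y (mem_head y s).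
rewrite big_cons; apply: (PD i) => //; last exact: IHs.
by apply/graded_partP; exists s.
Qed.

Lemma sub_graded_part D Q Q' :
  subpred Q Q' -> {subset graded_part D Q <= graded_part D Q'}.
Proof.
move=> QQ' x /graded_partP[s Ds ->]; apply/graded_partP; exists s => //.
by move=> y /Ds[i /QQ' Qi Dy]; exists i.
Qed.

(** Merging the summands of equal degree gives pairwise distinct indices, as the independence clause
    of [direct_decomposition] requires. *)
Lemma graded_part_family D Q x :
    (forall i, zmod_closed (D i)) -> x \in graded_part D Q ->
  exists s : seq I, exists2 c : I -> V,
    [/\ uniq s, all Q s & {in s, forall i, c i \in D i}]
    & x = \sum_(i <- s) c i.
Proof.
move=> Dz; move: x; apply: graded_part_ind => [|i x y Qi Dx _].
  by exists [::]; exists (fun=> 0); rewrite ?big_nil.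
case=> s [c [s_uniq Qs Dc] ->].
have [si|s'i] := boolP (i \in s).
  exists s; exists (fun j => if j == i then x + c i else c j).
    split=> // j sj; case: eqP => [->|_]; last exact: Dc.
    by have [_ ->] := GRing.zmod_closedD (Dz i); rewrite ?Dc.
  rewrite !(big_rem i si) /= eqxx addrA; congr (_ + _).
  apply: eq_big_seq => j; rewrite mem_rem_uniq // inE.
  by case: eqP.
exists (i :: s); exists (fun j => if j == i then x else c j).
  split; rewrite /= ?s'i ?Qi // => j; rewrite inE.
  by case: eqP => [->|_ /=]; [|exact: Dc].
rewrite big_cons eqxx; congr (_ + _); apply: eq_big_seq => j sj.
by case: eqP sj s'i => // -> ->.
Qed.

Lemma graded_part_disjoint D Q x : direct_decomposition D ->
  x \in graded_part D Q -> x \in graded_part D (predC Q) -> x = 0.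
Proof.
move=> [Dz _ D_indep] /(graded_part_family Dz)[s [c [s_uniq Qs Dc] ->]].
case/(graded_part_family Dz)=> t [d [t_uniq Qt Dd] eq_cd].
(* The two expressions of [x] involve disjoint sets of degrees, so their difference is a single
   family indexed by [s ++ t], to which independence applies. *)
pose e i := if Q i then c i else - d i.
have eE : {in s, forall i, c i = e i}.
  by move=> i si; rewrite /e (allP Qs).
have e0 : {in s ++ t, forall i, e i = 0}.
  apply: D_indep.
  - rewrite cat_uniq s_uniq t_uniq andbT; apply/hasPn => i /(allP Qt) /= Qi.
    by apply: contra Qi => /(allP Qs).
  - move=> i; rewrite mem_cat /e; case: ifP => Qi /orP[si|ti].
    + exact: Dc.
    + by have := allP Qt i ti; rewrite /= Qi.
    + by have := allP Qs i si; rewrite /= Qi.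
    + by apply: (GRing.zmod_closedN (Dz i)); apply: Dd.
  rewrite big_cat /= -(eq_big_seq _ eE) eq_cd -big_split big1_seq //= => i ti.
  by rewrite /e; have /negPf/= -> := allP Qt i ti; rewrite subrr.
rewrite big1_seq //= => i si; rewrite eE ?e0 //.
by rewrite mem_cat si.
Qed.

End GradedPart.

(** * Projections onto the components with degrees in a given set *)

Section Projection.
Variables (I : eqType) (V : zmodType) (D : I -> {pred V}).
Hypothesis dirD : direct_decomposition D.
Implicit Type Q : pred I.

Lemma graded_part_split Q x : exists y,
  y \in graded_part D Q /\ x - y \in graded_part D (predC Q).
Proof.
have [_ D_span _] := dirD.
move: x (D_span x); apply: graded_part_ind => [|i x y _ Dx _ [z [Qz Q'z]]].
  by exists 0; rewrite subrr; split; apply: graded_part0.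
have [Qi|Q'i] := boolP (Q i).
  exists (x + z); rewrite opprD addrACA subrr add0r; split=> //.
  by rewrite graded_partD // (graded_part_hom Qi).
exists z; rewrite -addrA graded_partD //.
exact: (graded_part_hom (i := i)).
Qed.

(** The value is picked by choice; [graded_part_disjoint] makes it unique, whence [gproj_eq] and
    additivity. *)
Definition gproj Q x : V := projT1 (cid (graded_part_split Q x)).

Lemma gproj_in Q x : gproj Q x \in graded_part D Q.
Proof. by rewrite /gproj; case: cid => y []. Qed.

Lemma sub_gproj_in Q x : x - gproj Q x \in graded_part D (predC Q).
Proof. by rewrite /gproj; case: cid => y []. Qed.

Let part_closed Q : zmod_closed (graded_part D Q).
Proof. by have [Dz _ _] := dirD; apply: graded_part_closed. Qed.

Lemma gproj_eq Q x y : y \in graded_part D Q ->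
  x - y \in graded_part D (predC Q) -> gproj Q x = y.
Proof.
move=> Qy Q'y; apply/eqP; rewrite -subr_eq0; apply/eqP.
apply: (graded_part_disjoint dirD (Q := Q)).
  by case: (part_closed Q) => _ -> //; exact: gproj_in.
have -> : gproj Q x - y = (x - y) - (x - gproj Q x).
  by rewrite opprB [RHS]addrC addrA subrK.
by case: (part_closed (predC Q)) => _ -> //; exact: sub_gproj_in.
Qed.

Fact gproj_zmod_morphism Q : zmod_morphism (gproj Q).
Proof.
move=> x y; apply: gproj_eq.
  by case: (part_closed Q) => _ -> //; exact: gproj_in.
have -> : x - y - (gproj Q x - gproj Q y) = (x - gproj Q x) - (y - gproj Q y).
  by rewrite !opprB addrACA [- y - _]addrC addrACA.
by case: (part_closed (predC Q)) => _ -> //; exact: sub_gproj_in.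
Qed.

HB.instance Definition _ Q :=
  GRing.isZmodMorphism.Build V V (gproj Q) (gproj_zmod_morphism Q).

Lemma gproj_id Q x : x \in graded_part D Q -> gproj Q x = x.
Proof. by move=> Qx; apply: gproj_eq; rewrite // subrr graded_part0. Qed.

Lemma gproj_out Q x : x \in graded_part D (predC Q) -> gproj Q x = 0.
Proof. by move=> Qx; apply: gproj_eq; rewrite ?subr0 // graded_part0. Qed.

Lemma gproj_hom Q i x : x \in D i -> gproj Q x = if Q i then x else 0.
Proof.
case: ifPn => Qi Dx; first by apply: gproj_id; apply: graded_part_hom Dx.
by apply: gproj_out; apply: graded_part_hom Dx.
Qed.

Lemma gproj1_in i x : gproj (pred1 i) x \in D i.
Proof.
have [Dz _ _] := dirD; have [D0 DD] := GRing.zmod_closedD (Dz i).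
move: (gproj _ x) (gproj_in (pred1 i) x).
by apply: graded_part_ind => // _ x' y /eqP-> Dx _; apply: DD.
Qed.

Lemma gproj_comp_in Q i x : x \in D i -> gproj Q x \in D i.
Proof.
have [Dz _ _] := dirD; have [D0 _] := Dz i.
by move=> Dx; rewrite (gproj_hom _ Dx); case: ifP.
Qed.

Lemma direct_ind (P : V -> Prop) :
    P 0 -> (forall i x y, x \in D i -> P y -> P (x + y)) -> forall x, P x.
Proof.
have [_ D_span _] := dirD.
move=> P0 PD x; move: x (D_span x); apply: graded_part_ind => // i x y _ Dx _.
exact: (PD i).
Qed.

Lemma eq_gproj Q Q' x : Q =1 Q' -> gproj Q x = gproj Q' x.
Proof. by move=> /funext->. Qed.

Lemma gproj_gproj Q Q' x :
  gproj Q (gproj Q' x) = gproj (fun i => Q i && Q' i) x.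
Proof.
move: x; apply: direct_ind => [|i x y Dx IHy]; first by rewrite !raddf0.
rewrite !raddfD /= IHy !(gproj_hom _ Dx) /=; congr (_ + _).
by case: (Q' i); rewrite ?raddf0 ?(gproj_hom _ Dx) ?andbT ?andbF.
Qed.

Lemma gproj1_neq0 x : x != 0 -> exists i, gproj (pred1 i) x != 0.
Proof.
move=> x_neq0; apply: contrapT => proj0; case/eqP: x_neq0.
have {}proj0 i : gproj (pred1 i) x = 0.
  by apply/eqP; apply: contrapT => /negP xi; apply: proj0; exists i.
have [Dz D_span _] := dirD.
have [s [c [s_uniq _ Dc] x_def]] := graded_part_family Dz (D_span x).
rewrite x_def big1_seq //= => i si; rewrite -[RHS](proj0 i) x_def raddf_sum.
rewrite (bigD1_seq i) //= (gproj_hom _ (Dc i si)) /= eqxx.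
rewrite big1_seq ?addr0 // => j /andP[ji sj].
by rewrite (gproj_hom _ (Dc j sj)) /= (negPf ji).
Qed.

(** Stability under taking components is the form in which homogeneity is mostly used and checked
    below. *)
Lemma homogeneousP (N : {pred V}) : zmod_closed N ->
  homogeneous D N <-> {in N, forall x i, gproj (pred1 i) x \in N}.
Proof.
move=> /GRing.zmod_closedD[N0 ND].
split=> [homN x Nx i|projN x Nx].
  move/homN: Nx; move: x; apply: graded_part_ind => [|j x y _ + _ IHy].
    by rewrite raddf0.
  rewrite inE => /andP[Dx Nx]; rewrite raddfD /= (gproj_hom _ Dx).
  by apply: ND IHy; case: ifP.
have [Dz D_span _] := dirD.
have [s [c [s_uniq _ Dc] x_def]] := graded_part_family Dz (D_span x).
have projx i : i \in s -> gproj (pred1 i) x = c i.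
  move=> si; rewrite x_def raddf_sum (bigD1_seq i) //= (gproj_hom _ (Dc i si)).
  rewrite /= eqxx big1_seq ?addr0 // => j /andP[ji sj].
  by rewrite (gproj_hom _ (Dc j sj)) /= (negPf ji).
rewrite x_def -(eq_big_seq _ projx).
apply: (big_ind (fun y => y \in graded_part _ _)).
- exact: graded_part0.
- exact: graded_partD.
move=> i _; apply: (@graded_part_hom _ _ _ _ i) => //.
by rewrite inE /= gproj1_in projN.
Qed.

End Projection.

(** The shift [h] is [id] for graded maps and addition of [j] for multiplication by an element of
    degree [j]. *)
Lemma gproj_morph (I J : eqType) (V W : zmodType) (D : I -> {pred V})
    (D' : J -> {pred W}) (dirD : direct_decomposition D)
    (dirD' : direct_decomposition D') (f : {additive V -> W}) (h : I -> J)
    (Q : pred I) (Q' : pred J) x :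
    (forall i y, y \in D i -> f y \in D' (h i)) -> (forall i, Q' (h i) = Q i) ->
  gproj dirD' Q' (f x) = f (gproj dirD Q x).
Proof.
move=> fD QQ'; move: x; apply: (direct_ind dirD) => [|i x y Dx IHy].
  by rewrite !raddf0.
rewrite !raddfD /= IHy (gproj_hom _ _ Dx) (gproj_hom _ _ (fD i x Dx)) QQ'.
by case: ifP; rewrite ?raddf0.
Qed.

(** * Projections of rings and modules onto their Veroneses *)

Section VeroneseProjection.
Variables (n : nat) (R : gradedRing).
Implicit Type M : gradedModule R.

Lemma gprojZ M (j : nat) (a : R) (Q Q' : pred int) x : a \in gring_comp j ->
    (forall i, Q' (j%:Z + i) = Q i) ->
  gproj (gmod_direct M) Q' (a *: x) = a *: gproj (gmod_direct M) Q x.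
Proof.
move=> Ra QQ'.
apply: (gproj_morph _ _ (f := *:%R a) (h := fun i => j%:Z + i)) => // i y.
exact: gmod_compZ.
Qed.

Lemma gprojM (j : nat) (a : R) (Q Q' : pred nat) x : a \in gring_comp j ->
    (forall i, Q' (j + i)%N = Q i) ->
  gproj (gring_direct R) Q' (a * x) = a * gproj (gring_direct R) Q x.
Proof.
move=> Ra QQ'.
apply: (gproj_morph _ _ (f := a \*o @idfun R) (h := fun i => (j + i)%N)) => //.
move=> i y; exact: gring_compM.
Qed.

Definition vproj M (x : M) : veronese_mod n M :=
  Sub (gproj (gmod_direct M) (fun i => (n%:Z %| i)%Z) x) (gproj_in _ _ _).

Definition vring_proj (a : R) : veronese_ring n R :=
  Sub (gproj (gring_direct R) (fun i => (n %| i)%N) a) (gproj_in _ _ _).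

Fact vproj_zmod_morphism M : zmod_morphism (@vproj M).
Proof. by move=> x y; apply: val_inj; rewrite /= raddfB. Qed.

HB.instance Definition _ M := GRing.isZmodMorphism.Build M (veronese_mod n M)
  (@vproj M) (@vproj_zmod_morphism M).

Fact vring_proj_zmod_morphism : zmod_morphism vring_proj.
Proof. by move=> x y; apply: val_inj; rewrite /= raddfB. Qed.

HB.instance Definition _ := GRing.isZmodMorphism.Build R (veronese_ring n R)
  vring_proj vring_proj_zmod_morphism.

Lemma vproj_comp M i (x : M) : x \in gmod_comp i -> vproj x \in gmod_comp i.
Proof. by move=> Mx; rewrite inE /= gproj_comp_in. Qed.

Lemma vring_proj_comp i a : a \in gring_comp i -> vring_proj a \in gring_comp i.
Proof. by move=> Mx; rewrite inE /= gproj_comp_in. Qed.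

Lemma vring_proj1 : vring_proj 1 = 1.
Proof.
by apply: val_inj; rewrite /= (gproj_hom _ _ (gring_comp1 R)) dvdn0.
Qed.

Lemma vring_projM (a : veronese_ring n R) b :
  vring_proj (val a * b) = a * vring_proj b.
Proof.
case: a => a Va; apply: val_inj => /=; move: a Va.
apply: graded_part_ind => [|i x y ni Rx _ IHy]; first by rewrite !mul0r raddf0.
rewrite !mulrDl raddfD /= IHy; congr (_ + _); apply: gprojM Rx _ => j.
by rewrite dvdn_addr.
Qed.

Lemma vprojZ M (a : veronese_ring n R) (x : M) :
  vproj (val a *: x) = a *: vproj x.
Proof.
case: a => a Va; apply: val_inj => /=; move: a Va.
apply: graded_part_ind => [|i b c ni Rb _ IHc].
  by rewrite !scale0r raddf0.
rewrite !scalerDl raddfD /= IHc; congr (_ + _); apply: gprojZ Rb _ => j.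
by rewrite rpredDl.
Qed.

(** All degrees of [x] are divisible by [n]; a component of [a] keeps them so if [n] divides its
    degree, and otherwise moves [x] entirely into degrees that the projection kills. *)
Lemma vprojZr M (a : R) (x : veronese_mod n M) :
  vproj (a *: val x) = vring_proj a *: x.
Proof.
apply: val_inj => /=; move: a.
apply: (direct_ind (gring_direct R)) => [|i a b Ra IHb].
  by rewrite !raddf0 !scale0r raddf0.
rewrite raddfD /= !scalerDl raddfD /= IHb (gproj_hom _ _ Ra); congr (_ + _).
case: ifPn => ni.
  rewrite (gprojZ _ Ra (Q := fun j => (n%:Z %| j)%Z)) => [|j].
    by rewrite gproj_id //; exact: (valP x).
  by rewrite rpredDl.
rewrite (gprojZ _ Ra (Q := fun j => (n%:Z %| i%:Z + j)%Z)) // gproj_out.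
  by rewrite scaler0 scale0r.
move: (valP x); apply: sub_graded_part => j nj /=.
by rewrite rpredDr.
Qed.

End VeroneseProjection.

(** * The coinduced graded module *)

Section Coinduced.
Variables (n : nat) (R : gradedRing) (F : gradedModule (veronese_ring n R)).

(** Linearity is an equation through [val] because [R] is not packaged as a module over its Veronese
    ring. *)
Definition coind_comp (i : int) : {pred R -> F} := fun h =>
  `[< (forall (a : veronese_ring n R) r s, h (val a * r + s) = a *: h r + h s)
    /\ forall (j : nat) r, r \in gring_comp j -> h r \in gmod_comp (j%:Z + i)>].

Lemma coind_compP i h : reflect
  ((forall (a : veronese_ring n R) r s, h (val a * r + s) = a *: h r + h s)
    /\ forall (j : nat) r, r \in gring_comp j -> h r \in gmod_comp (j%:Z + i))
  (h \in coind_comp i).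
Proof. exact: asboolP. Qed.

Fact coind_comp_closed i : zmod_closed (coind_comp i).
Proof.
have [Fz _ _] := gmod_direct F.
split=> [|g h /coind_compP[g_lin g_comp] /coind_compP[h_lin h_comp]].
  apply/coind_compP; split=> [a r s|j r _]; first by rewrite scaler0 addr0.
  by case: (Fz (j%:Z + i)).
apply/coind_compP; split=> [a r s|j r Rr].
  by rewrite !fctE g_lin h_lin scalerBr opprD addrACA.
rewrite !fctE; case: (Fz (j%:Z + i)) => _ -> //.
  exact: g_comp.
exact: h_comp.
Qed.

Definition coind_pred : {pred R -> F} := graded_part coind_comp xpredT.

Fact coind_zmod : zmod_closed coind_pred.
Proof. by apply: graded_part_closed; apply: coind_comp_closed. Qed.

HB.instance Definition _ := GRing.isZmodClosed.Build (R -> F) coind_pred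
  coind_zmod.

(* The graded module *Hom_{R^(n)}(R, F). *)
Definition coind_sort := {h : R -> F | h \in coind_pred}.
HB.instance Definition _ := SubChoice.on coind_sort.
HB.instance Definition _ := [SubChoice_isSubZmodule of coind_sort by <:].

Lemma coind_pred_lin h : h \in coind_pred ->
  forall (a : veronese_ring n R) r s, h (val a * r + s) = a *: h r + h s.
Proof.
move: h; apply: graded_part_ind => [|i g h _ /coind_compP[g_lin _] _ IHh] a r s.
  by rewrite scaler0 addr0.
by rewrite !fctE g_lin IHh scalerDr addrACA.
Qed.

Fact coind_zmod_morphism (h : coind_sort) : zmod_morphism (val h).
Proof.
move=> r s; have := coind_pred_lin (valP h) (-1) s r.
by rewrite raddfN /= mulN1r scaleN1r addrC => ->; rewrite addrC.
Qed.

Lemma coind_comp_scale i j (a : R) h :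
    a \in gring_comp j -> h \in coind_comp i ->
  (fun r => h (a * r)) \in coind_comp (j%:Z + i).
Proof.
move=> Ra /coind_compP[h_lin h_comp]; apply/coind_compP; split=> [b r s|l r Rr].
  by rewrite mulrDr mulrCA h_lin.
by rewrite addrCA addrA -PoszD; apply/h_comp/gring_compM.
Qed.

Fact coind_scale_subproof (a : R) (h : coind_sort) :
  (fun r => val h (a * r)) \in coind_pred.
Proof.
case: h => h Hh /=; move: h Hh.
apply: graded_part_ind => [|i g h _ Hg _ IHh]; first exact: graded_part0.
rewrite -[X in X \in _]/((fun r => g (a * r)) + (fun r => h (a * r))).
apply: graded_partD => //; move: a {IHh}.
(* Scaling a homogeneous map gives a homogeneous map only for homogeneous [a], hence a second
   induction, on [a]. *)
apply: (direct_ind (gring_direct R)) => [|j a b Ra IHb].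
  have -> : (fun r => g (0 * r)) = 0; last exact: graded_part0.
  apply/funext => r; rewrite mul0r.
  have /coind_compP[g_lin _] := Hg.
  by have := g_lin (-1) 0 0; rewrite mulr0 addr0 scaleN1r addNr.
have -> : (fun r => g ((a + b) * r)) =
    (fun r => g (a * r)) + (fun r => g (b * r)).
  apply/funext => r; rewrite !fctE mulrDl.
  have /coind_compP[g_lin _] := Hg.
  by have := g_lin 1 (a * r) (b * r); rewrite mul1r scale1r.
by apply: graded_partD => //; apply: graded_part_hom (coind_comp_scale Ra Hg).
Qed.

Definition coind_scale (a : R) (h : coind_sort) : coind_sort :=
  Sub (fun r => val h (a * r)) (coind_scale_subproof a h).

Fact coind_scalerA a b x :
  coind_scale a (coind_scale b x) = coind_scale (a * b) x.
Proof. by apply: val_inj; apply/funext => r /=; rewrite mulrA (mulrC a). Qed.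

Fact coind_scale1r : left_id 1 coind_scale.
Proof. by move=> x; apply: val_inj; apply/funext => r /=; rewrite mul1r. Qed.

Fact coind_scalerDr : right_distributive coind_scale +%R.
Proof. by move=> a x y; apply: val_inj; apply/funext => r /=. Qed.

Fact coind_scalerDl x : {morph coind_scale^~ x : a b / a + b}.
Proof.
move=> a b; apply: val_inj; apply/funext => r /=; rewrite mulrDl.
have := coind_pred_lin (valP x) 1 (a * r) (b * r).
by rewrite mul1r scale1r.
Qed.

HB.instance Definition _ := GRing.Zmodule_isLmodule.Build R
  coind_sort coind_scalerA coind_scale1r coind_scalerDr coind_scalerDl.

Definition coind_mod_comp (i : int) : {pred coind_sort} :=
  [pred h | val h \in coind_comp i].

(** Independence is tested pointwise: at an argument of degree [j], maps of distinct degrees [l]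
    take values in the distinct degrees [j + l] of [F]. *)
Fact coind_direct : direct_decomposition coind_mod_comp.
Proof.
have [Fz _ F_indep] := gmod_direct F.
split.
- move=> i; have [h0 hB] := coind_comp_closed i.
  by split=> [|g h]; rewrite !inE //; apply: hB.
- move=> h; have: exists2 t : seq coind_sort,
      {in t, forall y, exists2 i, xpredT i & y \in coind_mod_comp i}
      & val h = val (\sum_(y <- t) y).
    case: h => h Hh; rewrite [val _]/=; move: h Hh.
    apply: graded_part_ind => [|i g h _ Hg _ [t Ht ->]].
      by exists [::]; rewrite // big_nil.
    have g_in : g \in coind_pred by apply: graded_part_hom Hg.
    exists ((Sub g g_in : coind_sort) :: t); last by rewrite big_cons raddfD /=.
    move=> y; rewrite inE => /predU1P[->|/Ht//].
    by exists i.
  by case=> t Ht /val_inj ->; apply/graded_partP; exists t.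
- move=> s c s_uniq Hc c0 i si.
  suff c0r r : val (c i) r = 0 by apply: val_inj; apply/funext.
  move: r; apply: (direct_ind (gring_direct R)) => [|j a b Ra IHb].
    by have := coind_zmod_morphism (c i) 0 0; rewrite !subrr.
  have := coind_pred_lin (valP (c i)) 1 a b; rewrite mul1r scale1r => ->.
  rewrite IHb addr0.
  have inj : injective (fun l : int => j%:Z + l) by exact: addrI.
  (* The values at [a], reindexed by their degree in [F]. *)
  pose d l := val (c (l - j%:Z)) a.
  have := F_indep [seq j%:Z + l | l <- s] d.
  rewrite map_inj_uniq // s_uniq => /(_ isT).
  have dE l : d (j%:Z + l) = val (c l) a by rewrite /d addrC addKr.
  move=> /(_ _ _ (j%:Z + i)); rewrite dE; apply.
  + move=> _ /mapP[l sl ->]; rewrite dE.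
    by have /coind_compP[_] := Hc l sl; apply.
  + rewrite big_map; under eq_bigr => l _ do rewrite dE.
    have := congr1 (fun h : coind_sort => val h a) c0.
    by rewrite raddf_sum fct_sumE.
  + by apply/mapP; exists i.
Qed.

Fact coind_compZ i j (a : R) x : a \in gring_comp i -> x \in coind_mod_comp j ->
  a *: x \in coind_mod_comp (i%:Z + j).
Proof. by rewrite !inE; apply: coind_comp_scale. Qed.

Definition coind_mod : gradedModule R := GradedModule coind_direct coind_compZ.

End Coinduced.

(** The bound on [m] ensures that an element not killed by the [n]-th power of a generator is not
    killed by its [m]-th power either. *)
Lemma exists_mul_dvdz (n d : nat) (i : int) : (0 < n)%N -> coprime d n ->
  exists2 m, (m <= n)%N & (n%:Z %| (m * d)%N%:Z + i)%Z.
Proof.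
move=> n_gt0 co_dn; have n_neq0 : n%:Z != 0 by rewrite -lt0n.
pose s := `|((- i) %% n%:Z)%Z|%N.
(* By the Chinese remainder theorem [e] is a multiple of [d] congruent to [- i] modulo [n]. *)
pose e := chinese n d s 0.
have co_nd : coprime n d by rewrite coprime_sym.
have /dvdnP[m e_md] : (d %| e)%N by rewrite /dvdn chinese_modr // mod0n.
exists (m %% n)%N; first by rewrite ltnW ?ltn_pmod.
have := chinese_modl co_nd s 0; rewrite -/e e_md => eq_md.
rewrite -[i]opprK -eqz_mod_dvd -[X in _ == X]modz_mod.
have <- : s%:Z = (- i %% n%:Z)%Z by rewrite gez0_abs ?modz_ge0.
by rewrite !modz_nat eqz_nat modnMml eq_md.
Qed.

(** * Annihilators over a positively graded algebra *)

Section PositivelyGraded.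
Variables (k : fieldType) (R : posGradedAlgebra k).

Lemma irrelevant_idealD :
  {in irrelevant_ideal R &, forall a b, a + b \in irrelevant_ideal R}.
Proof. by move=> a b; apply: graded_partD. Qed.

Lemma irrelevant_idealM (a b : R) :
  b \in irrelevant_ideal R -> a * b \in irrelevant_ideal R.
Proof.
move: b; apply: graded_part_ind => [|i b c i_gt0 Rb _ IHc].
  by rewrite mulr0 graded_part0.
rewrite mulrDr graded_partD // {IHc c}.
move: a; apply: (direct_ind (pga_direct R)) => [|j a c Ra IHc].
  by rewrite mul0r graded_part0.
rewrite mulrDl graded_partD //.
apply: (graded_part_hom (i := (j + i)%N)); last exact: pga_compM.
by rewrite addn_gt0 i_gt0 orbT.
Qed.

Lemma scalar_irrelevant (c : k) : c%:A \in irrelevant_ideal R -> c = 0.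
Proof.
move=> c_irr; apply/eqP; apply: contraT => c_neq0.
suff: c%:A = 0 :> R.
  by move/eqP; rewrite scaler_eq0 oner_eq0 (negPf c_neq0).
apply: (graded_part_disjoint (gring_direct R) c_irr).
apply: (graded_part_hom (i := 0%N)) => //.
by apply/pga_comp0; exists c.
Qed.

Variable gens : seq R.
Hypothesis gens_alg : alg_generated gens.
Hypothesis gens_irr : {subset gens <= irrelevant_ideal R}.

(** The elements admitting such a splitting form a subalgebra containing the generators.
    Consequently [R] acts on [x] through constant terms. *)
Lemma annihilated_split (M : lmodType R) (x : M) :
    {in gens, forall g, g *: x = 0} -> forall a : R,
  exists c : k,
    exists2 b, b \in irrelevant_ideal R & a = c%:A + b /\ b *: x = 0.
Proof.
move=> gens0 a.
pose S : {pred R} := fun a => `[< exists c : k,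
  exists2 b, b \in irrelevant_ideal R & a = c%:A + b /\ b *: x = 0 >].
suff: a \in S by move/asboolP.
apply: gens_alg => [|g gens_g]; last first.
  apply/asboolP; exists 0; exists g; first exact: gens_irr.
  by rewrite scale0r add0r gens0.
split.
- apply/asboolP; exists 1; exists 0; first exact: graded_part0.
  by rewrite scale1r addr0 scale0r.
- move=> l _ _ /asboolP[c [b b_irr [-> bx0]]] /asboolP[d [e e_irr [-> ex0]]].
  apply/asboolP; exists (l * c + d); exists (l *: b + e).
    by rewrite irrelevant_idealD // -mulr_algl irrelevant_idealM.
  split; first by rewrite scalerDr scalerA addrACA -scalerDl.
  by rewrite scalerDl -mulr_algl -scalerA bx0 ex0 scaler0 addr0.
- move=> _ _ /asboolP[c [b b_irr [-> bx0]]] /asboolP[d [e e_irr [-> ex0]]].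
  (* The positive-degree part of the product (c + b)(d + e), grouped so that each term has a factor
     killing [x]. *)
  apply/asboolP; exists (c * d); exists (c%:A * e + (d%:A + e) * b).
    by rewrite irrelevant_idealD // irrelevant_idealM.
  split.
    by rewrite mulrDl mulrDr [c%:A * d%:A]mulr_algl scalerA [b * _]mulrC addrA.
  by rewrite scalerDl -!scalerA bx0 ex0 !scaler0 addr0.
Qed.

(** The prime is the annihilator of [x]: an element kills [x] exactly when its constant term
    vanishes, nonzero constants being invertible. *)
Lemma Ass_irrelevant (M : lmodType R) (x : M) : x != 0 ->
    {in gens, forall g, g *: x = 0} ->
  exists2 P, in_Ass M P & P =i irrelevant_ideal R.
Proof.
move=> x_neq0 gens0; have splitP := annihilated_split gens0.
have annP (c : k) b : b *: x = 0 -> (c%:A + b) *: x = 0 -> c = 0.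
  move=> bx0; rewrite scalerDl bx0 addr0 => cx0.
  apply/eqP; apply: contraT => c_neq0; case/negP: x_neq0; apply/eqP.
  have : c^-1%:A *: (c%:A *: x) = 0 by rewrite cx0 scaler0.
  by rewrite scalerA mulr_algl scalerA mulVf // scale1r scale1r.
pose P : {pred R} := fun a => a *: x == 0.
have inP a : (a \in P) = (a *: x == 0) by [].
exists P; last first.
  move=> a; rewrite inP; have [c [b b_irr [-> bx0]]] := splitP a.
  apply/eqP/idP => [/(annP _ _ bx0)-> | a_irr]; first by rewrite scale0r add0r.
  suff -> : c = 0 by rewrite scale0r add0r.
  apply: scalar_irrelevant; rewrite -[c%:A](addrK b) irrelevant_idealD //.
  by rewrite -mulN1r irrelevant_idealM.
split; last by exists x => a; rewrite inP; split=> /eqP.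
split; first split.
- by rewrite inP scale0r.
- by rewrite inP scale1r.
- move=> a u v; rewrite !inP scalerDl -scalerA => /eqP-> /eqP->.
  by rewrite scaler0 addr0.
move=> a a'; have [c [b _ [-> bx0]]] := splitP a.
have [d [e _ [-> ex0]]] := splitP a'.
rewrite !inP => /eqP abx0.
(* Constant terms multiply, so primality follows from [k] having no zero divisors. *)
have : c * d = 0.
  apply: (annP _ (c%:A * e + (d%:A + e) * b)).
    by rewrite scalerDl -!scalerA bx0 ex0 !scaler0 addr0.
  rewrite -[RHS]abx0; congr (_ *: _).
  rewrite [RHS]mulrDl mulrDr [c%:A * d%:A]mulr_algl scalerA.
  by rewrite [b * _]mulrC addrA.
move/eqP; rewrite mulf_eq0 => /orP[]/eqP->; apply/orP; [left|right];
  by rewrite scale0r add0r ?bx0 ?ex0.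
Qed.

End PositivelyGraded.

(** * Nonzero multiples in degrees divisible by [n] *)

Section Reach.
Variables (n : nat) (R : gradedRing) (N : gradedModule R) (gens : seq R).
Hypothesis n_gt0 : (0 < n)%N.
Hypothesis gens_hom :
  {in gens, forall g, exists2 d, coprime d n & g \in gring_comp d}.
Hypothesis gens_faithful : forall i (x : N), x \in gmod_comp i -> x != 0 ->
  exists2 g, g \in gens & g *: x != 0.

Lemma gring_compX d (g : R) m :
  g \in gring_comp d -> g ^+ m \in gring_comp (m * d).
Proof.
move=> Rg; elim: m => [|m IHm]; first exact: gring_comp1.
by rewrite exprS mulSn gring_compM.
Qed.

Lemma last_nonzero_power (g : R) (x : N) m : x != 0 -> g ^+ m *: x = 0 ->
  exists2 l, g ^+ l *: x != 0 & g ^+ l.+1 *: x = 0.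
Proof.
move=> x_neq0; elim: m => [|m IHm] gx0.
  by rewrite scale1r in gx0; rewrite gx0 eqxx in x_neq0.
have [/IHm//|gmx] := eqVneq (g ^+ m *: x) 0.
by exists m.
Qed.

(** Otherwise, treating the generators one by one and multiplying each time by the last power that
    does not kill, one reaches a nonzero multiple of [x] killed by all generators, against
    [gens_faithful]. *)
Lemma nonnilpotent_generator i (x : N) : x \in gmod_comp i -> x != 0 ->
  exists j a g, [/\ a \in gring_comp j, g \in gens & g ^+ n *: (a *: x) != 0].
Proof.
move=> Nx x_neq0; apply: contrapT => nil.
have {}nil j a g : a \in gring_comp j -> g \in gens -> g ^+ n *: (a *: x) = 0.
  move=> Ra gens_g; apply/eqP; apply: contrapT => /negP gax.
  by apply: nil; exists j, a, g.
suff [j [a [Ra ax_neq0 gax0]]] : exists j a, [/\ a \in gring_comp j,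
    a *: x != 0 & {in gens, forall g, g *: (a *: x) = 0}].
  have [g /gax0 ->] := gens_faithful (gmod_compZ Ra Nx) ax_neq0.
  by rewrite eqxx.
have : {subset gens <= gens} by [].
(* The induction runs over a list of generators already made to kill the multiple; its inclusion in
   [gens] is kept as a hypothesis. *)
elim: {-2}gens => [|g s IHs] sub_gens.
  by exists 0%N, 1; rewrite gring_comp1 scale1r.
have [h sh|j [a [Ra ax_neq0 sax0]]] := IHs.
  by apply: sub_gens; rewrite inE sh orbT.
have gens_g : g \in gens by apply: sub_gens; apply: mem_head.
have [l gl_neq0 gl0] := last_nonzero_power ax_neq0 (nil _ _ _ Ra gens_g).
have [d _ Rg] := gens_hom gens_g.
exists (l * d + j)%N, (g ^+ l * a); rewrite gring_compM ?gring_compX //.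
rewrite -scalerA; split=> // h; rewrite inE => /predU1P[->|sh].
  by rewrite scalerA -exprS.
by rewrite scalerA mulrC -scalerA sax0 ?scaler0.
Qed.

Lemma reach_multiple i (x : N) : x \in gmod_comp i -> x != 0 ->
  exists j a, [/\ a \in gring_comp j, a *: x != 0 & (n%:Z %| j%:Z + i)%Z].
Proof.
move=> Nx x_neq0.
have [j [a [g [Ra gens_g gax]]]] := nonnilpotent_generator Nx x_neq0.
have [d co_dn Rg] := gens_hom gens_g.
have [m le_mn n_dvd] := exists_mul_dvdz (j%:Z + i) n_gt0 co_dn.
exists (m * d + j)%N, (g ^+ m * a); rewrite gring_compM ?gring_compX //.
rewrite PoszD -addrA; split=> //; rewrite -scalerA.
(* Since [m <= n], if the [m]-th power of [g] killed [a *: x], so would the [n]-th. *)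
apply: contraNneq gax => gmax0.
by rewrite -(subnK le_mn) exprD -scalerA gmax0 scaler0.
Qed.

End Reach.

(** If all generators killed [x], the line spanned by [x] over [k] would be a graded submodule and
    so would meet [M]; the irrelevant ideal would then be associated to [M]. *)
Lemma essential_faithful (k : fieldType) (R : posGradedAlgebra k) (gens : seq R)
    (M E : gradedModule R) (iota : gradedHom M E) :
    alg_generated gens -> {subset gens <= irrelevant_ideal R} ->
    (forall P : {pred R}, in_Ass M P -> in_Proj P) ->
    injective iota -> star_essential iota ->
  forall i (x : E), x \in gmod_comp i -> x != 0 ->
  exists2 g, g \in gens & g *: x != 0.
Proof.
move=> gens_alg gens_irr AssM iota_inj iota_ess i x Ex x_neq0.
apply: contrapT => killed.
have {}killed : {in gens, forall g, g *: x = 0}.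
  move=> g gens_g; apply/eqP; apply: contrapT => /negP gx.
  by apply: killed; exists g.
pose S : {pred E} := fun y => `[< exists c : k, y = (c%:A : R) *: x >].
have S_closed : submod_closed S.
  split=> [|a _ _ /asboolP[c ->] /asboolP[d ->]].
    by apply/asboolP; exists 0; rewrite !scale0r.
  have [l [b _ [-> bx0]]] := annihilated_split gens_alg gens_irr killed a.
  apply/asboolP; exists (l * c + d).
  have -> : (l%:A + b) *: ((c%:A : R) *: x) = ((l * c)%:A : R) *: x.
    rewrite scalerDl [b *: _]scalerA [b * _]mulrC -[(_ * b) *: x]scalerA bx0.
    by rewrite scaler0 addr0 scalerA mulr_algl scalerA.
  by rewrite -!scalerDl.
have S_hom : homogeneous (@gmod_comp R E) S.
  move=> y Sy; apply: (graded_part_hom (i := i)) => //.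
  rewrite inE /= Sy andbT; case/asboolP: Sy => c ->.
  rewrite -[i]add0r; apply: (@gmod_compZ _ E 0%N) => //.
  by apply/pga_comp0; exists c.
have [|y /asboolP[c y_def] y_neq0] := iota_ess S S_closed S_hom.
  by exists x => //; apply/asboolP; exists 1; rewrite !scale1r.
have [||P AssP P_irr] := Ass_irrelevant gens_alg gens_irr (x := y).
- by apply: contraNneq y_neq0 => ->; rewrite raddf0.
- move=> g gens_g; apply: iota_inj; rewrite linearZ /= raddf0 y_def.
  by rewrite scalerA mulrC -scalerA killed ?scaler0.
by have [_ _ /(_ P_irr)] := AssM P AssP.
Qed.

Lemma veronese_hom_vproj (n : nat) (R : gradedRing) (M N : gradedModule R)
    (f : gradedHom M N) x :
  veronese_hom n f (vproj n x) = vproj n (f x).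
Proof.
apply: val_inj; symmetry; apply: (gproj_morph _ _ (h := id)) => // i y.
exact: ghom_comp.
Qed.

(** * Essential extensions of the Veronese of the hull *)

Section VeroneseHull.
Variables (n : nat) (R : gradedRing) (M E : gradedModule R).
Variable iota : gradedHom M E.
Hypothesis iota_inj : injective iota.
Hypothesis iota_ess : star_essential iota.
Hypothesis reachE : forall i (x : E), x \in gmod_comp i -> x != 0 ->
  exists j a, [/\ a \in gring_comp j, a *: x != 0 & (n%:Z %| j%:Z + i)%Z].

(** A nonzero component of [x] has a nonzero multiple in a degree divisible by [n], and that
    multiple is a component of [a *: x] that [vproj] keeps. *)
Lemma vproj_faithful (x : E) : (forall a, vproj n (a *: x) = 0) -> x = 0.
Proof.
move=> ax0; apply/eqP; apply: contraT => /(gproj1_neq0 (gmod_direct E))[i xi].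
have [j [a [Ra + n_dvd]]] := reachE (gproj1_in (gmod_direct E) i x) xi.
rewrite -(gprojZ (Q' := pred1 (j%:Z + i)) _ Ra) => [|l]; last first.
  by rewrite /= (inj_eq (addrI _)).
have := congr1 (gproj (gmod_direct E) (pred1 (j%:Z + i)) \o val) (ax0 a).
rewrite /= gproj_gproj raddf0 => proj0; case/eqP; rewrite -[RHS]proj0.
by apply: eq_gproj => l /=; case: eqP => // ->.
Qed.

Lemma veronese_essential : star_essential (veronese_hom n iota).
Proof.
move=> S S_closed S_hom [y Sy y_neq0].
have [S0 SZD] := S_closed; have Sz := GRing.submod_closedB S_closed.
have [_ SD] := GRing.zmod_closedD Sz.
have projS := (homogeneousP (gmod_direct (veronese_mod n E)) Sz).1 S_hom.
(* [T] is an [R]-submodule of [E] containing [S], to which essentiality over [R] applies. *)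
pose T : {pred E} := fun e => `[< forall b, vproj n (b *: e) \in S >].
have T_closed : submod_closed T.
  split=> [|a u v /asboolP Tu /asboolP Tv]; apply/asboolP => b.
    by rewrite scaler0 raddf0.
  rewrite scalerDr scalerA raddfD /=.
  by apply: SD; [exact: Tu | exact: Tv].
have T_hom : homogeneous (@gmod_comp R E) T.
  apply/(homogeneousP (gmod_direct E) (GRing.submod_closedB T_closed)).
  move=> e /asboolP Te i; apply/asboolP.
  apply: (direct_ind (gring_direct R)) => [|j a b Ra IHb].
    by rewrite scale0r raddf0.
  (* For [a] of degree [j], multiplying the degree [i] component of [e] by [a] gives the degree
     [j + i] component of [a *: e]. *)
  rewrite scalerDl raddfD SD // -(gprojZ (Q' := pred1 (j%:Z + i)) _ Ra) => [|l].
    rewrite -(gproj_morph (gmod_direct E) (gmod_direct (veronese_mod n E))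
      (f := @vproj n R E) (h := id) (Q' := pred1 (j%:Z + i))) => [||//].
      exact: (projS _ (Te a)).
    by move=> l x; apply: vproj_comp.
  by rewrite /= (inj_eq (addrI _)).
have [|x /asboolP Tx x_neq0] := iota_ess T_closed T_hom.
  exists (val y); last by apply: contraNneq y_neq0 => y0; apply/eqP/val_inj.
  apply/asboolP => b; rewrite vprojZr -[_ *: _]addr0; exact: SZD.
(* The element found in [T] may lie outside the Veronese; a suitable multiple has a nonzero
   projection, which lies in [S]. *)
have [a ax_neq0] : exists a, vproj n (a *: iota x) != 0.
  apply: contrapT => ax0; case/eqP: x_neq0; apply: vproj_faithful => a.
  by apply/eqP; apply: contrapT => /negP ax; apply: ax0; exists a.
exists (vproj n (a *: x)); rewrite veronese_hom_vproj linearZ //.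
exact: Tx.
Qed.

Variables (F : gradedModule (veronese_ring n R)).
Variable g : gradedHom (veronese_mod n E) F.
Hypothesis g_inj : injective g.
Hypothesis g_ess : star_essential (g \o veronese_hom n iota).

Let multiples : pred int := fun i => (n%:Z %| i)%Z.

Lemma gproj_veroneseZ (a : veronese_ring n R) (y : F) :
  gproj (gmod_direct F) multiples (a *: y)
    = a *: gproj (gmod_direct F) multiples y.
Proof.
move: a; apply: (direct_ind (gring_direct (veronese_ring n R))).
  by rewrite !scale0r raddf0.
move=> i a b Ra IHb.
rewrite !scalerDl raddfD /= IHb; congr (_ + _).
have [ni|ni] := boolP (n %| i)%N.
  by rewrite (gprojZ (Q := multiples) _ Ra) // => j; rewrite /multiples rpredDl.
(* The Veronese ring is zero in degrees not divisible by [n]. *)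
have -> : a = 0; last by rewrite !scale0r raddf0.
apply/val_inj; apply: (graded_part_disjoint (gring_direct R) (valP a)).
exact: (graded_part_hom (i := i)).
Qed.

(** The elements of [F] without components in degrees divisible by [n] form a graded submodule. It
    meets the image of the Veronese of [M] only in 0, so it vanishes. *)
Lemma veronese_extension_degree i (y : F) :
  y \in gmod_comp i -> ~~ (n%:Z %| i)%Z -> y = 0.
Proof.
move=> Fy ni; apply/eqP; apply: contraT => y_neq0.
pose S : {pred F} := fun z => gproj (gmod_direct F) multiples z == 0.
have inS z : (z \in S) = (gproj (gmod_direct F) multiples z == 0) by [].
have S_closed : submod_closed S.
  split=> [|a u v]; rewrite !inS ?raddf0 // raddfD /= gproj_veroneseZ.
  by move=> /eqP-> /eqP->; rewrite scaler0 addr0.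
have S_hom : homogeneous (@gmod_comp _ F) S.
  apply/(homogeneousP (gmod_direct F) (GRing.submod_closedB S_closed)).
  move=> z; rewrite inS => /eqP Sz j; rewrite inS gproj_gproj.
  rewrite (eq_gproj _ (Q' := fun l => pred1 j l && multiples l)) => [|l].
    by rewrite -gproj_gproj Sz raddf0.
  by rewrite andbC.
have [|x Sx x_neq0] := g_ess S_closed S_hom.
  by exists y => //; rewrite inS (gproj_hom _ _ Fy) /multiples (negPf ni).
case/negP: x_neq0; rewrite -(eqP Sx) eq_sym; apply/eqP.
rewrite (gproj_morph (gmod_direct (veronese_mod n M)) _ (h := id)
  (f := g \o veronese_hom n iota) (Q := multiples)) //; last first.
  by move=> j z Mz; do 2!apply: ghom_comp.
congr (_ _); apply: val_inj.
rewrite -(gproj_morph _ (gmod_direct M) (h := id)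
  (f := (val : {additive veronese_mod n M -> M})) (Q' := multiples)) //.
by rewrite gproj_id //; apply: (valP x).
Qed.

Fact hull_coind_subproof (x : E) :
  (fun a => g (vproj n (a *: x))) \in coind_pred (F := F).
Proof.
move: x; apply: (direct_ind (gmod_direct E)) => [|i x y Ex IHy].
  have -> : (fun a : R => g (vproj n (a *: (0 : E)))) = 0.
    by apply/funext => a; rewrite scaler0 !raddf0.
  exact: graded_part0.
have -> : (fun a => g (vproj n (a *: (x + y)))) =
    (fun a => g (vproj n (a *: x))) + (fun a => g (vproj n (a *: y))).
  by apply/funext => a; rewrite scalerDr !raddfD.
apply: graded_partD => //; apply: (graded_part_hom (i := i)) => //.
apply/coind_compP; split=> [a r s|j r Rr].
  by rewrite scalerDl -scalerA raddfD /= vprojZ linearP.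
by apply/ghom_comp/vproj_comp/gmod_compZ.
Qed.

(** Adjoint to [g \o vproj] under restriction and coinduction. *)
Definition hull_coind (x : E) : coind_mod F :=
  Sub (fun a => g (vproj n (a *: x))) (hull_coind_subproof x).

Fact hull_coind_linear : linear hull_coind.
Proof.
move=> a x y; apply: val_inj; apply/funext => r /=.
by rewrite scalerDr !raddfD /= scalerA mulrC.
Qed.

HB.instance Definition _ := GRing.isLinear.Build R E (coind_mod F) *:%R
  hull_coind hull_coind_linear.

Fact hull_coind_comp i x : x \in gmod_comp i -> hull_coind x \in gmod_comp i.
Proof.
move=> Ex; apply/coind_compP; split=> [a r s|j r Rr] /=.
  by rewrite scalerDl -scalerA raddfD /= vprojZ linearP.
by apply/ghom_comp/vproj_comp/gmod_compZ.
Qed.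

Definition hull_coind_hom : gradedHom E (coind_mod F) :=
  @GradedHom _ E (coind_mod F) hull_coind hull_coind_comp.

Lemma hull_coind_inj : injective hull_coind.
Proof.
apply: raddf_inj => x x0; apply: vproj_faithful => a; apply: g_inj.
by rewrite raddf0 -[LHS]/(val (hull_coind x) a) x0.
Qed.

Fact ext_coind_subproof (y : F) :
  (fun a => vring_proj n a *: y) \in coind_pred (F := F).
Proof.
move: y; apply: (direct_ind (gmod_direct F)) => [|i x y Fx IHy].
  have -> : (fun a : R => vring_proj n a *: (0 : F)) = 0.
    by apply/funext => a; rewrite scaler0.
  exact: graded_part0.
have -> : (fun a : R => vring_proj n a *: (x + y)) =
    (fun a => vring_proj n a *: x) + (fun a => vring_proj n a *: y).
  by apply/funext => a; rewrite scalerDr.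
apply: graded_partD => //; apply: (graded_part_hom (i := i)) => //.
apply/coind_compP; split=> [a r s|j r Rr].
  by rewrite raddfD /= vring_projM scalerDl scalerA.
by apply/gmod_compZ => //; apply: vring_proj_comp.
Qed.

(** Precomposition with the retraction [vring_proj] of [R] onto its Veronese ring, [y] being seen as
    the map sending a scalar to its product with [y]. *)
Definition ext_coind (y : F) : coind_mod F :=
  Sub (fun a => vring_proj n a *: y) (ext_coind_subproof y).

Fact ext_coind_zmod_morphism : zmod_morphism ext_coind.
Proof.
by move=> x y; apply: val_inj; apply/funext => r; rewrite /= scalerBr.
Qed.

HB.instance Definition _ := GRing.isZmodMorphism.Build F (coind_mod F)
  ext_coind ext_coind_zmod_morphism.

Lemma ext_coindZ (a : veronese_ring n R) y :
  ext_coind (a *: y) = val a *: ext_coind y.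
Proof.
apply: val_inj; apply/funext => r /=.
by rewrite vring_projM !scalerA mulrC.
Qed.

Lemma ext_coind_comp i y : y \in gmod_comp i -> ext_coind y \in gmod_comp i.
Proof.
move=> Fy; apply/coind_compP; split=> [a r s|j r Rr] /=.
  by rewrite raddfD /= vring_projM scalerDl scalerA.
by apply/gmod_compZ => //; apply: vring_proj_comp.
Qed.

Lemma ext_coind_g x : ext_coind (g x) = hull_coind (val x).
Proof. by apply: val_inj; apply/funext => r /=; rewrite vprojZr linearZ. Qed.

(** A nonzero value forces [n] to divide [j + i]. At [r] of degree divisible by [n] the two sides
    agree by linearity of [h]; at any other degree both vanish, [F] being zero there. *)
Lemma coind_ext i j (h : coind_mod F) (a : R) :
    h \in gmod_comp i -> a \in gring_comp j -> val h a != 0 ->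
  a *: h = ext_coind (val h a).
Proof.
move=> Hh Ra ha_neq0; have /coind_compP[h_lin h_comp] := Hh.
have n_dvd : (n%:Z %| j%:Z + i)%Z.
  apply: contraT => ndvd; case/eqP: ha_neq0.
  exact: veronese_extension_degree (h_comp j a Ra) ndvd.
have hD r s : val h (r + s) = val h r + val h s.
  by have := h_lin 1 r s; rewrite mul1r scale1r.
have h0 : val h 0 = 0.
  by have := h_lin (-1) 0 0; rewrite mulr0 addr0 scaleN1r addNr.
apply: val_inj; apply/funext; apply: (direct_ind (gring_direct R)).
  by rewrite /= mulr0 h0 raddf0 scale0r.
move=> l r s Rr IHs.
have -> : val (a *: h) (r + s) = val (a *: h) r + val (a *: h) s.
  by rewrite /= mulrDr hD.
rewrite IHs /= raddfD /= scalerDl; congr (_ + _).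
have [nl|nl] := boolP (n %| l)%N.
  have rE : val (vring_proj n r) = r by rewrite /= (gproj_hom _ _ Rr) nl.
  by rewrite mulrC -{1}rE -[_ * a]addr0 h_lin h0 addr0.
have -> : vring_proj n r = 0.
  by apply: val_inj; rewrite /= (gproj_hom _ _ Rr) (negPf nl).
have Rar := gring_compM Ra Rr.
rewrite scale0r; apply: (veronese_extension_degree (h_comp _ _ Rar)).
by rewrite PoszD addrAC rpredDl.
Qed.

Lemma hull_coind_essential : star_essential (hull_coind \o iota).
Proof.
move=> S S_closed S_hom [h Sh h_neq0].
have Sz := GRing.submod_closedB S_closed.
have projS := (homogeneousP (gmod_direct (coind_mod F)) Sz).1 S_hom.
have SZ a x : x \in S -> a *: x \in S.
  by move=> Sx; rewrite -[_ *: _]addr0; apply: S_closed.2 => //; case: S_closed.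
(* The essentiality of [F] is applied to the preimage of [S], which is nonzero by [coind_ext] at a
   homogeneous component of [h]. *)
pose S' : {pred F} := fun y => ext_coind y \in S.
have inS' y : (y \in S') = (ext_coind y \in S) by [].
have S'_closed : submod_closed S'.
  split=> [|a u v]; rewrite !inS'; first by rewrite raddf0; case: S_closed.
  by move=> Su Sv; rewrite raddfD /= ext_coindZ; apply: S_closed.2.
have S'_hom : homogeneous (@gmod_comp _ F) S'.
  apply/(homogeneousP (gmod_direct F) (GRing.submod_closedB S'_closed)) => y.
  rewrite !inS' => Sy i; rewrite inS'.
  rewrite -(gproj_morph (gmod_direct F) (gmod_direct (coind_mod F))
    (h := id) (f := ext_coind) (Q' := pred1 i)) //; last exact: ext_coind_comp.
  exact: (projS _ _ _).
have [i hi_neq0] := gproj1_neq0 (gmod_direct (coind_mod F)) h_neq0.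
have Hhi := gproj1_in (gmod_direct (coind_mod F)) i h.
have := projS h Sh i.
move: (gproj _ _ h) hi_neq0 Hhi => {Sh h h_neq0} h h_neq0 Hh Sh.
have [j [a [Ra ha_neq0]]] : exists j a, a \in gring_comp j /\ val h a != 0.
  apply: contrapT => h0; case/eqP: h_neq0; apply: val_inj; apply/funext.
  apply: (direct_ind (gring_direct R)) => [|j a b Ra IHb].
    by have := coind_zmod_morphism h 0 0; rewrite !subrr.
  have := coind_pred_lin (valP h) 1 a b; rewrite mul1r scale1r => ->.
  rewrite IHb; apply/eqP; rewrite addr0; apply: contrapT => /negP ha.
  by apply: h0; exists j, a.
have [|x Sx x_neq0] := g_ess S'_closed S'_hom.
  by exists (val h a) => //; rewrite inS' -(coind_ext Hh Ra ha_neq0) SZ.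
exists (val x); first by move: Sx; rewrite inS' /= ext_coind_g.
apply: contraNneq x_neq0 => /= ix0.
have /hull_coind_inj ix0' : hull_coind (iota (val x)) = hull_coind 0.
  by rewrite ix0 raddf0.
suff -> : veronese_hom n iota x = 0 by rewrite raddf0.
exact: val_inj.
Qed.

End VeroneseHull.

Theorem corollary3p11 (n : nat) (k : fieldType) (R : posGradedAlgebra k)
    (M E : gradedModule R) (iota : gradedHom M E) :
  (1 <= n)%N ->
  (exists2 gens : seq R,
      {in gens, forall x, exists2 d, coprime d n & x \in pga_comp d}
    & alg_generated gens) ->
  (forall P : {pred R}, in_Ass M P -> in_Proj P) ->
  star_injective_hull iota ->
  star_injective_hull (veronese_hom n iota).
Proof.
move=> n_gt0 [gens gens_hom gens_alg] AssM [iota_inj iota_ess E_max].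
have reachE i (x : E) : x \in gmod_comp i -> x != 0 ->
    exists j a, [/\ a \in gring_comp j, a *: x != 0 & (n%:Z %| j%:Z + i)%Z].
  (* For [n = 1] generators of degree 0 are allowed, but every degree is divisible by 1. For larger
     [n], coprimality forces positive degrees. *)
  have [n_gt1|n_le1] := ltnP 1 n; last first.
    have -> : n = 1%N by apply/eqP; rewrite eqn_leq n_le1.
    by move=> _ x_neq0; exists 0%N, 1; rewrite scale1r dvd1z gring_comp1.
  apply: (reach_multiple n_gt0 gens_hom).
  apply: (essential_faithful gens_alg _ AssM iota_inj iota_ess) => g.
  case/gens_hom => -[|d] co_dn Rg; last exact: (graded_part_hom (i := d.+1)).
  by move: co_dn n_gt1; rewrite /coprime gcd0n => /eqP->.
split.
- by move=> x y /(congr1 val) /= /iota_inj xy; apply: val_inj.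
- exact: veronese_essential.
move=> F g g_inj g_ess y.
have [x x_y] := E_max _ (hull_coind_hom g) (hull_coind_inj reachE g_inj)
  (hull_coind_essential reachE g_inj g_ess) (ext_coind y).
exists (vproj n x).
have := congr1 (fun h : coind_mod F => val h 1) x_y.
by rewrite /= scale1r vring_proj1 scale1r.
Qed.
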